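(* Let $d,N\ge 1$ be integers, let $H$ be a Hilbert space, and let $K:\Lambda_N\times\Lambda_N\to L(H)$ be a positive definite kernel satisfying $K_\Sigma\le K$ on $\Lambda_{N-1}\times\Lambda_{N-1}$. Suppose that the boundary data of $K$ at level $N$ are shift consistent. Then there exists a positive definite kernel $\widetilde K:\mathbb{F}^+_d\times\mathbb{F}^+_d\to L(H)$ with $\widetilde K_\Sigma\le\widetilde K$ on $\mathbb{F}^+_d\times\mathbb{F}^+_d$ and $$\widetilde K(\alpha,\beta)=K(\alpha,\beta),\qquad \alpha,\beta\in\Lambda_N.$$
   Context: $\mathbb{F}^+_d$ is the free semigroup (with neutral element, the empty word $\emptyset$) on the letters $\{1,\dots,d\}$; for $\alpha=i_1\cdots i_k$ the length is $|\alpha|=k$, and $\alpha i=i_1\cdots i_k i$ denotes concatenation. For an integer $m\ge 0$, $\Lambda_m=\{\alpha\in\mathbb{F}^+_d:|\alpha|\le m\}$, and $\Lambda_{-1}=\emptyset$ (the empty set). $L(H)$ is the space of bounded linear operators on $H$. For $E\subset\mathbb{F}^+_d$, a kernel $K:E\times E\to L(H)$ is positive definite (on $E$) if $\sum_{j,k=1}^m\langle u_j,K(\alpha_j,\alpha_k)u_k\rangle_H\ge 0$ for every finite family $(\alpha_j,u_j)_{j=1}^m$ in $E\times H$. The shifted kernel is $K_\Sigma(\alpha,\beta)=\sum_{i=1}^d K(\alpha i,\beta i)$, defined whenever $\alpha i,\beta i\in E$ for all $i$. For $F\subset E$ on which both kernels are defined, $K_\Sigma\le K$ on $F$ (equivalently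 on $F\times F$) means that $K-K_\Sigma$ is positive definite on $F$. Kolmogorov space: for positive definite $K$ on $\Lambda_N$, $H_K^{(N)}$ is the Hilbert space with bounded operators $V_\alpha:H\to H_K^{(N)}$ ($\alpha\in\Lambda_N$) such that the vectors $V_\alpha u$ ($\alpha\in\Lambda_N$, $u\in H$) have dense linear span and $\langle V_\alpha u,V_\beta v\rangle_{H_K^{(N)}}=\langle u,K(\alpha,\beta)v\rangle_H$, i.e. $K(\alpha,\beta)=V_\alpha^*V_\beta$ (unique up to unitary equivalence). Set $H_K^{(N-1)}=\overline{\mathrm{span}}\{V_\alpha u:\alpha\in\Lambda_{N-1},u\in H\}\subset H_K^{(N)}$. Shift consistency: the boundary data of $K$ at level $N$ are shift consistent if there exist bounded operators $T_1,\dots,T_d$ on $H_K^{(N-1)}$ such that $\sum_{i=1}^d T_i^*T_i\le I_{H_K^{(N-1)}}$; $T_iV_\alpha u=V_{\alpha i}u$ for all $\alpha\in\Lambda_{N-2}$, $u\in H$ and $i=1,\dots,d$; and, for all $\alpha,\beta\in\Lambda_{N-1}$, $u,v\in H$ and $i,j\in\{1,\dots,d\}$, $$\langle V_\alpha u,T_iV_\beta v\rangle_{H_K^{(N)}}=\langle u,K(\alpha,\beta i)v\rangle_H\quad\text{and}\quad \langle T_iV_\alpha u,T_jV_\beta v\rangle_{H_K^{(N)}}=\langle u,K(\alpha i,\beta j)v\rangle_H.$$ *)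

(* Defs.v *)
From HB Require Import structures.
From mathcomp Require Import all_boot all_order all_algebra.
From mathcomp Require Import sesquilinear complex.
From mathcomp Require Import boolp classical_sets functions reals topology.
From mathcomp Require Import normedtype.

Set Implicit Arguments.
Unset Strict Implicit.
Unset Printing Implicit Defensive.

Import Order.TTheory GRing.Theory Num.Theory.
Import numFieldNormedType.Exports.

Local Open Scope classical_set_scope.
Local Open Scope ring_scope.

(* Hilbert spaces are over the complex numbers R[i]. As for every [{dot _ for _}],
   the inner product is linear in its first argument and conjugate-linear in its
   second one; all notions below are insensitive to this choice. *)
HB.mixin Record CompleteNormedModule_isHilbert (R : realType) H
    & CompleteNormedModule R[i] H := {
  inner : {dot H for Num.conj};
  inner_normE : forall x : H, inner x x = `|x| ^+ 2
}.

#[short(type="hilbertType")]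
HB.structure Definition Hilbert (R : realType) :=
  {H of CompleteNormedModule R[i] H & CompleteNormedModule_isHilbert R H}.


Notation "''[' u , v ]" := (inner u%R v%R)
  (format "''[' u ,  v ]") : ring_scope.

Section BoundedOperators.
Variable R : realType.

Section Type_of_bounded_operators.
Variables U V : normedModType R[i].

Definition bounded_linear : {pred U -> V} := [pred f : U -> V |
  `[< linear f /\ exists M : R[i], forall x, `|f x| <= M * `|x| >]].

Record bop := Bop { bop_fun :> U -> V; bop_funP : bop_fun \in bounded_linear }.

HB.instance Definition _ := [isSub for bop_fun].
HB.instance Definition _ := [Choice of bop by <:].

Lemma bounded_linear_zmod_closed : zmod_closed bounded_linear.
Proof.
split=> [|f g /asboolP[lf [M Mf]] /asboolP[lg [N Ng]]]; apply/asboolP; split.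
- by move=> a x y; rewrite /= scaler0 addr0.
- by exists 0 => x; rewrite normr0 mul0r.
- move=> a x y; rewrite -[LHS]/(f _ - g _) -[RHS]/(a *: (f x - g x) + (f y - g y)).
  by rewrite lf lg scalerBr opprD addrACA.
- exists (M + N) => x; rewrite mulrDl (le_trans (ler_normB _ _))//.
  exact: lerD.
Qed.

HB.instance Definition _ :=
  GRing.isZmodClosed.Build (U -> V) bounded_linear bounded_linear_zmod_closed.
HB.instance Definition _ := [SubChoice_isSubZmodule of bop by <:].

Lemma bop_linear (f : bop) : linear f.
Proof. by have /asboolP[] := bop_funP f. Qed.

HB.instance Definition _ (f : bop) :=
  GRing.isLinear.Build R[i] U V _ f (bop_linear f).

End Type_of_bounded_operators.

Lemma bop_id_subproof (U : normedModType R[i]) :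
  (id : U -> U) \in @bounded_linear U U.
Proof. by apply/asboolP; split => //; exists 1 => x; rewrite mul1r. Qed.

Definition bop_id (U : normedModType R[i]) : bop U U := Bop (bop_id_subproof U).

Lemma bop_comp_subproof (U V W : normedModType R[i]) (g : bop V W)
  (f : bop U V) : (g \o f : U -> W) \in @bounded_linear U W.
Proof.
apply/asboolP; split => [a x y /=|]; first by rewrite !linearP.
have /asboolP[_ [M Mf]] := bop_funP f; have /asboolP[_ [N Ng]] := bop_funP g.
have [N0|N0] := boolP (0 <= N).
  by exists (N * M) => x; rewrite (le_trans (Ng _))// -mulrA ler_wpM2l.
exists 0 => x; rewrite mul0r normr_le0; apply: contraNT N0 => gf0.
have fx0 : 0 < `|f x|.
  by rewrite normr_gt0; apply: contra gf0 => /eqP fx /=; rewrite fx linear0.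
by rewrite -(pmulr_lge0 _ fx0) (le_trans _ (Ng _)).
Qed.

Definition bop_comp (U V W : normedModType R[i]) (g : bop V W) (f : bop U V) :
  bop U W := Bop (bop_comp_subproof g f).

End BoundedOperators.

Notation "''L(' U , V )" := (bop U V) (format "''L(' U ,  V )") : type_scope.

Section Subspaces.
Variables (R : realType) (H : hilbertType R).
Implicit Types A : set H.

Definition linear_span A : set H := [set x | exists n (c : 'I_n -> R[i])
  (v : 'I_n -> H), (forall i, A (v i)) /\ x = \sum_i c i *: v i].

(* The closure of the span, as a Hilbert space in its own right: [span_type]. *)
Definition closed_span A : {pred H} := mem (closure (linear_span A)).

Lemma sub_linear_span A : A `<=` linear_span A.
Proof.
move=> x Ax; exists 1%N, (fun=> 1), (fun=> x); split => //.
by rewrite big_ord1 scale1r.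
Qed.

Lemma linear_span0 A : linear_span A 0.
Proof.
exists 0%N, (fun=> 0), (fun=> 0); split; first by case.
by rewrite big_ord0.
Qed.

Lemma linear_spanP A (a : R[i]) x y :
  linear_span A x -> linear_span A y -> linear_span A (a *: x + y).
Proof.
move=> [n [c [v [Av ->]]]] [m [e [w [Aw ->]]]].
exists (n + m)%N,
  (fun i => match fintype.split i with inl j => a * c j | inr k => e k end),
  (fun i => match fintype.split i with inl j => v j | inr k => w k end); split.
  by move=> i; case: fintype.split.
rewrite big_split_ord/= scaler_sumr; congr (_ + _); apply: eq_bigr => i _.
  by rewrite (unsplitK (inl i)) scalerA.
by rewrite (unsplitK (inr i)).
Qed.

Lemma closed_span_submod A : submod_closed (closed_span A).
Proof.
split=> [|a x y]; first by apply/mem_set/subset_closure/linear_span0.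
move=> /set_mem Ax /set_mem Ay; apply/mem_set => B.
move=> /nbhs_ballP[e /= e0 xyB].
have k0 : 0 < `|a| + 1 by rewrite ltr_wpDl.
have e20 : 0 < e / 2 by rewrite divr_gt0.
have [x' [Ax' xx']] := Ax _ (nbhsx_ballx x _ (divr_gt0 e20 k0)).
have [y' [Ay' yy']] := Ay _ (nbhsx_ballx y _ e20).
exists (a *: x' + y'); split; first exact: linear_spanP.
apply: xyB; move: xx' yy'; rewrite -!ball_normE/= => xx' yy'.
rewrite opprD addrACA -scalerBr (splitr e) (le_lt_trans (ler_normD _ _))//.
rewrite ler_ltD// normrZ.
rewrite (@le_trans _ _ ((`|a| + 1) * `|x - x'|))//.
  by rewrite ler_wpM2r// lerDl.
by rewrite mulrC -ler_pdivlMr// ltW.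
Qed.

HB.instance Definition _ A :=
  GRing.isSubmodClosed.Build R[i] H (closed_span A) (closed_span_submod A).

Record span_type A := SpanType
  { span_val : H; span_valP : span_val \in closed_span A }.

Variable A : set H.
Local Notation S := (span_type A).

HB.instance Definition _ := [isSub for @span_val A].
HB.instance Definition _ := [Choice of S by <:].
HB.instance Definition _ := [SubChoice_isSubLmodule of S by <:].

Let nrm (x : S) : R[i] := `|val x|.

Let nrmD x y : nrm (x + y) <= nrm x + nrm y.
Proof. by rewrite /nrm raddfD ler_normD. Qed.

Let nrmZ (l : R[i]) x : nrm (l *: x) = `|l| * nrm x.
Proof. by rewrite /nrm linearZ normrZ. Qed.

Let nrm0_eq0 x : nrm x = 0 -> x = 0.
Proof.
by move=> /eqP; rewrite normr_eq0 => /eqP x0; apply: val_inj; rewrite x0 raddf0.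
Qed.

HB.instance Definition _ :=
  Lmodule_isNormed.Build R[i] S nrmD nrmZ nrm0_eq0.

Lemma span_complete (F : set_system S) : ProperFilter F -> cauchy F -> cvg F.
Proof.
move=> FF /cauchy_ballP Fc.
have Gc : cauchy (@span_val A @ F).
  apply/cauchy_ballP => e e0; rewrite !near_simpl.
  by have := Fc e e0; rewrite -!ball_normE.
have /cvg_ex[/= l Gl] : cvg (@span_val A @ F) by exact: cauchy_cvg.
have Sl : l \in closed_span A.
  apply/mem_set; apply: (closed_cvg _ (@closed_closure _ _) _ _ Gl).
  by apply: nearW => x; exact/set_mem/span_valP.
apply/cvg_ex; exists (SpanType Sl); apply/cvgrPdist_lt => e e0.
by have /cvgrPdist_lt/(_ e e0) := Gl.
Qed.

HB.instance Definition _ := Uniform_isComplete.Build S span_complete.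

Definition span_inner (x y : S) : R[i] := '[span_val x, span_val y].

Lemma span_inner_bilinear : bilinear_for ( *%R ) (Num.conj \; *%R) span_inner.
Proof.
by split => [u' a u v|u a u' v]; rewrite /span_inner/=;
  rewrite ?linearPl ?linearPr.
Qed.

HB.instance Definition _ :=
  bilinear_isBilinear.Build R[i] S S R[i] *%R (Num.conj \; *%R) span_inner
    span_inner_bilinear.

Lemma span_inner_hermitian (x y : S) :
  span_inner x y = (-1) ^+ false * Num.conj (span_inner y x).
Proof. by rewrite /span_inner hermC. Qed.

HB.instance Definition _ :=
  isHermitianSesquilinear.Build R[i] S false Num.conj span_inner
    span_inner_hermitian.

Lemma span_inner_gt0 (x : S) : x != 0 -> 0 < span_inner x x.
Proof.
move=> x0; rewrite /span_inner inner_normE exprn_gt0// normr_gt0.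
by apply: contra x0 => /eqP x0; apply/eqP/val_inj; rewrite raddf0.
Qed.

HB.instance Definition _ := isDotProduct.Build R[i] S span_inner span_inner_gt0.

Lemma span_inner_normE (x : S) : span_inner x x = `|x| ^+ 2.
Proof. exact: inner_normE. Qed.

HB.instance Definition _ :=
  CompleteNormedModule_isHilbert.Build R S span_inner_normE.

End Subspaces.

Section HilbertOperators.
Variables (R : realType) (G : hilbertType R).

Definition is_adjoint (T Ts : 'L(G, G)) : Prop :=
  forall x y : G, '[T x, y] = '[x, Ts y].

Definition op_le (A B : 'L(G, G)) : Prop :=
  forall x : G, 0 <= '[x, (B - A) x].

End HilbertOperators.

Section Kernels.
Variables (R : realType) (d : nat) (H : hilbertType R).

(* The empty word is [::] and the concatenation of a with the letter i is
   [rcons a i]. *)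
Definition word := seq 'I_d.

(* m is an integer so that [Lambda (-1)] is empty. *)
Definition Lambda (m : int) : set word := [set a | (size a)%:Z <= m].

(* A kernel on E x E is represented by a total function; its values outside of
   E x E are irrelevant. *)
Definition kernel := word -> word -> 'L(H, H).

Implicit Types (E : set word) (K : kernel).

Definition positive_definite_on E K : Prop :=
  forall (m : nat) (a : 'I_m -> word) (u : 'I_m -> H), (forall j, E (a j)) ->
    0 <= \sum_j \sum_k '[u j, K (a j) (a k) (u k)].

Definition kernel_le_on E K1 K2 : Prop :=
  positive_definite_on E (fun a b => K2 a b - K1 a b).

Definition shifted_kernel K : kernel :=
  fun a b => \sum_(i < d) K (rcons a i) (rcons b i).

Definition kolmogorov_vectors (G : hilbertType R) E (V : word -> 'L(H, G)) :
  set G := [set x | exists a u, E a /\ x = V a u].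

(* The second clause is K a b = (V a)^* (V b). *)
Definition kolmogorov_space E K (G : hilbertType R) (V : word -> 'L(H, G)) :=
  dense (linear_span (kolmogorov_vectors E V)) /\
  forall a b u v, E a -> E b -> '[V a u, V b v] = '[u, K a b v].

Section Shift.
Variables (N : nat) (G : hilbertType R) (V : word -> 'L(H, G)).

Definition kolmogorov_sub :=
  span_type (kolmogorov_vectors (Lambda (N%:Z - 1)) V).

(* V a u as an element of the subspace, 0 when it does not belong to it; see
   [val_kvec]. *)
Definition kvec (a : word) (u : H) : kolmogorov_sub := insubd 0 (V a u).

Lemma val_kvec a u : Lambda (N%:Z - 1) a -> \val (kvec a u) = V a u.
Proof.
move=> Na; rewrite /kvec insubdK//; apply/mem_set/subset_closure.
by apply: sub_linear_span; exists a, u.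
Qed.

Definition shift_consistent_in K : Prop :=
  exists T Ts : 'I_d -> 'L(kolmogorov_sub, kolmogorov_sub),
  [/\ forall i, is_adjoint (T i) (Ts i),
      op_le (\sum_(i < d) bop_comp (Ts i) (T i)) (bop_id _),
      forall i a u, Lambda (N%:Z - 2) a -> T i (kvec a u) = kvec (rcons a i) u,
      forall i a b u v, Lambda (N%:Z - 1) a -> Lambda (N%:Z - 1) b ->
        '[V a u, \val (T i (kvec b v))] = '[u, K a (rcons b i) v] &
      forall i j a b u v, Lambda (N%:Z - 1) a -> Lambda (N%:Z - 1) b ->
        '[\val (T i (kvec a u)), \val (T j (kvec b v))] =
        '[u, K (rcons a i) (rcons b j) v]].

End Shift.

(* By uniqueness of the Kolmogorov space up to unitary equivalence, it does not
   matter which one is used. *)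
Definition shift_consistent (N : nat) K : Prop :=
  exists (G : hilbertType R) (V : word -> 'L(H, G)),
    kolmogorov_space (Lambda N%:Z) K V /\ shift_consistent_in N V K.

End Kernels.

(* Main.v *)
Require Import Defs.
From mathcomp Require Import all_boot all_order all_algebra.
From mathcomp Require Import sesquilinear complex.
From mathcomp Require Import boolp classical_sets reals topology normedtype.

(** The shifts T_i give the values of the kernel on words of every length.
    Write M for the closed span of the vectors V_a u with |a| <= N - 1 and X for
    V_[] seen as an operator from H to M (the empty word has length at most
    N - 1 since N >= 1). For a word a = i_1 ... i_k put
      X_a = T_{i_k} ... T_{i_1} X,    Kt(a, b) = X_a^* X_b.
    A Gram kernel is positive definite ([orbit_kernel_pd]). A quadratic form of
    Kt is |x|^2 for some x in M, and the corresponding form of its shift is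
    sum_i |T_i x|^2, so sum_i T_i^* T_i <= I is exactly what gives
    Kt_Sigma <= Kt ([orbit_kernel_shift_le]).

    For the agreement with K, the relation T_i V_a u = V_{ai} u on words of length
    at most N - 2 yields X_a u = V_a u when |a| <= N - 1, hence
    X_{ai} u = T_i V_a u when |ai| <= N. The two boundary identities of shift
    consistency are then Kt(a, bi) = K(a, bi) for |a| <= N - 1, |bi| <= N, and
    Kt(ai, bj) = K(ai, bj) for |ai|, |bj| <= N. The pair ([], []) is left to the
    Kolmogorov factorization, and the pairs (ai, []) follow from ([], ai) by
    Hermitian symmetry.

    There remains the existence of X^* as a bounded operator. It comes
    from density rather than from a representation theorem: the vectors at which
    an adjoint has a value form a closed subspace, which contains every V_b v
    because <V_[] u, V_b v> = <u, K([], b) v>, and these span a dense subspace of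
    the Kolmogorov space ([adjoint_of_dense]). *)

Set Implicit Arguments.
Unset Strict Implicit.
Unset Printing Implicit Defensive.

Import Order.TTheory GRing.Theory Num.Theory.
Import numFieldNormedType.Exports.

Local Open Scope classical_set_scope.
Local Open Scope ring_scope.

(** * Inner products *)

Section InnerProduct.
Context (R : realType) (H : hilbertType R).
Implicit Types x y : H.

Lemma inner_conj x y : '[x, y] = Num.conj '[y, x].
Proof. by rewrite hermC expr0 mul1r. Qed.

Lemma inner_self_ge0 x : 0 <= '[x, x].
Proof. by rewrite inner_normE exprn_ge0. Qed.

Lemma inner_subr x y z : '[x, y - z] = '[x, y] - '[x, z].
Proof. exact: linearBr. Qed.

Lemma inner_sumr n x (y : 'I_n -> H) : '[x, \sum_i y i] = \sum_i '[x, y i].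
Proof. exact: linear_sumr. Qed.

(** Cauchy-Schwarz: with [c = '[x, y] / '[y, y]], the vector [x - c *: y] is
    orthogonal to [y], and its square norm is nonnegative. *)
Lemma norm_inner_le x y : `|'[x, y]| <= `|x| * `|y|.
Proof.
have [->|y0] := eqVneq y 0; first by rewrite linear0r !normr0 mulr0.
have yy0 : 0 < '[y, y] by rewrite inner_normE exprn_gt0// normr_gt0.
have yy0' : '[y, y] != 0 by rewrite gt_eqF.
set c := '[x, y] / '[y, y].
have xcy : '[x - c *: y, y] = 0.
  by rewrite linearBl linearZl_LR/= divfK// subrr.
have := inner_self_ge0 (x - c *: y).
rewrite inner_subr linearZr_LR/= xcy mulr0 subr0 linearBl linearZl_LR/=.
rewrite subr_ge0 /c (inner_conj y x) mulrAC -normCK ler_pdivrMr//.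
by rewrite !inner_normE -exprMn ler_pXn2r ?nnegrE ?mulr_ge0.
Qed.

Lemma inner_injr x y : (forall u, '[u, x] = '[u, y]) -> x = y.
Proof.
move=> xy; apply/eqP; rewrite -subr_eq0 -normr_eq0 -sqrf_eq0 -inner_normE.
by rewrite inner_subr xy subrr.
Qed.

Lemma inner_sum_sum m (x : 'I_m -> H) :
  \sum_j \sum_k '[x j, x k] = '[\sum_j x j, \sum_j x j].
Proof.
by rewrite linear_sumlz; apply: eq_bigr => j _; rewrite linear_sumr.
Qed.

End InnerProduct.

(** * Adjoints of bounded operators *)

Section Adjoint.
Context (R : realType) (U W : hilbertType R).
Implicit Types (A : 'L(U, W)) (u : U) (w : W).

Definition adjoint_pair A (B : 'L(W, U)) : Prop :=
  forall u w, '[A u, w] = '[u, B w].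

(** The vector [v] is the value that an adjoint of [A] must take at [w]; an
    operator has an adjoint as soon as every [w] has such a [v]. *)
Definition adjoint_value A w v : Prop := forall u, '[A u, w] = '[u, v].

Lemma bop_bound A : exists2 M : R[i], 0 <= M & forall u, `|A u| <= M * `|u|.
Proof.
have /asboolP[_ [M AM]] := bop_funP A; exists `|M|; first exact: normr_ge0.
move=> u; apply: le_trans (AM u) _.
have Mu0 : 0 <= M * `|u| by exact: le_trans (normr_ge0 _) (AM u).
by rewrite -(ger0_norm Mu0) normrM normr_id.
Qed.

Lemma adjoint_valueP A a w1 w2 v1 v2 : adjoint_value A w1 v1 ->
  adjoint_value A w2 v2 -> adjoint_value A (a *: w1 + w2) (a *: v1 + v2).
Proof.
by move=> Aw1 Aw2 u; rewrite !linearDr/= !linearZr_LR/= Aw1 Aw2.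
Qed.

(** This bound makes the adjoint both single-valued and Lipschitz wherever it is
    defined; it comes from [|v|^2 = '[A v, w]] and Cauchy-Schwarz. *)
Lemma adjoint_value_bound A (M : R[i]) w v : 0 <= M ->
  (forall u, `|A u| <= M * `|u|) -> adjoint_value A w v -> `|v| <= M * `|w|.
Proof.
move=> M0 AM Awv; have [->|v0] := eqVneq v 0; first by rewrite normr0 mulr_ge0.
have v_gt0 : 0 < `|v| by rewrite normr_gt0.
rewrite -(ler_pM2l v_gt0) -expr2 -inner_normE -Awv.
have := inner_self_ge0 v; rewrite -Awv => /ger0_norm <-.
apply: le_trans (norm_inner_le _ _) _.
by rewrite mulrA (mulrC `|v|) ler_wpM2r.
Qed.

Lemma adjoint_value_span A (D : set W) w :
  (forall w, D w -> exists v, adjoint_value A w v) ->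
  linear_span D w -> exists v, adjoint_value A w v.
Proof.
move=> AD [n [c [x [Dx ->]]]].
elim/big_ind: _ => [|w1 w2 [v1 A1] [v2 A2]|i _].
- by exists 0 => u; rewrite !linear0r.
- by exists (1 *: v1 + v2); rewrite -[w1]scale1r; exact: adjoint_valueP.
- have [v Av] := AD _ (Dx i).
  by exists (c i *: v) => u; rewrite !linearZr_LR/= Av.
Qed.

(** Choose values of the adjoint on the set where they exist. They form a
    Lipschitz function, so along points of this set tending to [w] they are Cauchy,
    and by completeness of [U] they have a limit, which is a value at [w] since
    the inner product is continuous. *)
Lemma adjoint_value_closed A w :
  closure [set w | exists v, adjoint_value A w v] w ->
  exists v, adjoint_value A w v.
Proof.
set C := (X in closure X) => Cw.
have [M M0 AM] := bop_bound A.
have M1 : 0 < M + 1 by rewrite ltr_wpDl.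
pose F := within C (nbhs w).
have FF : ProperFilter F by exact: within_nbhs_proper.
have /choice[f Af] : forall w, exists v, C w -> adjoint_value A w v.
  move=> x; have [[v Av]|nCx] := pselect (C x); first by exists v.
  by exists 0.
have f_lip x y : C x -> C y -> `|f x - f y| <= M * `|x - y|.
  move=> /Af Ax /Af Ay; apply: (adjoint_value_bound M0 AM).
  have := adjoint_valueP (-1) Ay Ax.
  by rewrite !scaleN1r (addrC (- f y)) (addrC (- y)).
have Fball e : 0 < e -> F [set x | C x /\ `|w - x| < e].
  move=> e0; have := nbhsx_ballx w e e0; rewrite /F /within/= -ball_normE.
  by apply: filterS => x /= xe Cx.
have Fc : cauchy (f @ F).
  apply: cauchy_exP => e e0.
  have e2 : 0 < e / 2 / (M + 1) by rewrite !divr_gt0.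
  have [x [Cx xw]] := filter_ex (Fball _ e2).
  (* The points of C near w are close to each other, so their images are too. *)
  exists (f x); apply: filterS (Fball _ e2) => y /= [Cy yw].
  rewrite -ball_normE/=; apply: le_lt_trans (f_lip _ _ Cx Cy) _.
  apply: (@le_lt_trans _ _ ((M + 1) * `|x - y|)).
    by rewrite ler_wpM2r// lerDl.
  rewrite mulrC -ltr_pdivlMr// (splitr e) mulrDl.
  rewrite -(subrKA w) (le_lt_trans (ler_normD _ _))// ltrD//.
  by rewrite distrC.
have /cvg_ex[/= v fv] : cvg (f @ F) by exact: cauchy_cvg.
exists v => u; apply/eqP; rewrite -subr_eq0 -normr_le0; apply/ler_addgt0Pr.
move=> e e0; rewrite add0r.
have k0 : 0 < `|A u| + `|u| + 1 by rewrite ltr_wpDl// addr_ge0.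
have e2 : 0 < e / (`|A u| + `|u| + 1) by rewrite divr_gt0.
have /cvgrPdist_lt/(_ _ e2) fv_e := fv.
have [x /= [[Cx wx] vx]] := filter_ex (filterI (Fball _ e2) fv_e).
have -> : '[A u, w] - '[u, v] = '[A u, w - x] - '[u, v - f x].
  by rewrite !inner_subr (Af x Cx) opprB addrA subrK.
rewrite (le_trans (ler_normB _ _))//.
rewrite (le_trans (lerD (norm_inner_le _ _) (norm_inner_le _ _)))//.
rewrite (@le_trans _ _ ((`|A u| + `|u|) * (e / (`|A u| + `|u| + 1))))//.
  by rewrite mulrDl lerD// ler_wpM2l// ltW.
by rewrite mulrCA ger_pMr// ler_pdivrMr// mul1r lerDl.
Qed.

(** The vectors at which the adjoint has a value form a closed subspace, which is
    everything once it contains a set with dense span. Uniqueness of the values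
    then makes the adjoint linear. *)
Lemma adjoint_of_dense A (D : set W) : dense (linear_span D) ->
  (forall w, D w -> exists v, adjoint_value A w v) ->
  exists B, adjoint_pair A B.
Proof.
move=> Dd AD.
have /choice[f Af] : forall w, exists v, adjoint_value A w v.
  move=> w; apply: adjoint_value_closed => B; rewrite nbhsE => -[O [oO Ow] OB].
  have [x [Ox Dx]] := Dd O (ex_intro _ _ Ow) oO.
  by exists x; split; [exact: adjoint_value_span Dx|exact: OB].
have [M M0 AM] := bop_bound A.
have f_lin : linear f.
  move=> a w1 w2; apply: inner_injr => u; rewrite -Af.
  exact: adjoint_valueP.
have f_bop : f \in @bounded_linear R W U.
  by apply/asboolP; split => //; exists M => w; exact: adjoint_value_bound.
by exists (Bop f_bop) => u w; exact: Af.
Qed.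

End Adjoint.

Lemma adjoint_pair_comp (R : realType) (U V W : hilbertType R) (A : 'L(U, V)) B
    (C : 'L(V, W)) D : adjoint_pair A B -> adjoint_pair C D ->
  adjoint_pair (bop_comp C A) (bop_comp B D).
Proof. by move=> AB CD u w; rewrite /= CD AB. Qed.

(** * The Gram kernel of an orbit of a row of operators *)

Section RowContraction.
Context (R : realType) (d : nat) (H M : hilbertType R).

Lemma bop_subE (U V : normedModType R[i]) (A B : 'L(U, V)) u :
  (A - B) u = A u - B u.
Proof. by []. Qed.

Lemma bop_sumE (U V : normedModType R[i]) n (A : 'I_n -> 'L(U, V)) u :
  (\sum_i A i) u = \sum_i A i u.
Proof. exact: (big_morph (fun A : 'L(U, V) => A u)). Qed.

Variables (X : 'L(H, M)) (Xs : 'L(M, H)) (T Ts : 'I_d -> 'L(M, M)).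
Hypotheses (XXs : adjoint_pair X Xs) (TTs : forall i, is_adjoint (T i) (Ts i)).

(** [orbit (i_1 ... i_k)] is T_{i_k} ... T_{i_1} X: the last letter acts last, so
    that appending a letter to the word is applying an operator. *)
Definition orbit (a : word d) : 'L(H, M) :=
  foldl (fun A i => bop_comp (T i) A) X a.

Definition orbit_adj (a : word d) : 'L(M, H) :=
  foldl (fun B i => bop_comp B (Ts i)) Xs a.

Lemma orbit_rcons a i u : orbit (rcons a i) u = T i (orbit a u).
Proof. by rewrite /orbit -cats1 foldl_cat. Qed.

Lemma orbit_adjP a : adjoint_pair (orbit a) (orbit_adj a).
Proof.
elim/last_ind: a => [//|a i IH].
rewrite /orbit /orbit_adj -cats1 !foldl_cat/=.
exact: adjoint_pair_comp IH (TTs i).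
Qed.

Definition orbit_kernel : kernel d H :=
  fun a b => bop_comp (orbit_adj a) (orbit b).

Lemma orbit_kernelE a b u v :
  '[u, orbit_kernel a b v] = '[orbit a u, orbit b v].
Proof. by rewrite /orbit_kernel/= -orbit_adjP. Qed.

Lemma orbit_kernel_pd : positive_definite_on setT orbit_kernel.
Proof.
move=> m a u _; under eq_bigr do under eq_bigr do rewrite orbit_kernelE.
rewrite inner_sum_sum; exact: inner_self_ge0.
Qed.

(** Appending the letter [i] to all the words of a finite family turns
    [x = \sum_j orbit (a j) (u j)] into [T i x], so that the quadratic form of the
    kernel minus its shift is [|x|^2 - \sum_i |T i x|^2]. *)
Lemma orbit_kernel_shift_le :
  op_le (\sum_(i < d) bop_comp (Ts i) (T i)) (bop_id M) ->
  kernel_le_on setT (shifted_kernel orbit_kernel) orbit_kernel.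
Proof.
move=> TsT m a u _; pose x := \sum_j orbit (a j) (u j).
have -> : \sum_j \sum_k '[u j, (orbit_kernel (a j) (a k)
    - shifted_kernel orbit_kernel (a j) (a k)) (u k)]
  = '[x, x] - \sum_(i < d) '[T i x, T i x].
  under [in RHS]eq_bigr do rewrite /x linear_sum -inner_sum_sum.
  rewrite [in RHS]exchange_big -inner_sum_sum -sumrB; apply: eq_bigr => j _.
  rewrite [in RHS]exchange_big -sumrB; apply: eq_bigr => k _.
  rewrite bop_subE inner_subr orbit_kernelE.
  congr (_ - _); rewrite /shifted_kernel bop_sumE inner_sumr.
  by apply: eq_bigr => i _; rewrite orbit_kernelE !orbit_rcons.
(* Only a generic vector matters now; y hides the sum that defines x. *)
have := TsT x; move: (x) => y; rewrite bop_subE inner_subr bop_sumE.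
rewrite inner_sumr.
have <- : \sum_(i < d) '[T i y, T i y]
  = \sum_(i < d) '[y, bop_comp (Ts i) (T i) y].
  by apply: eq_bigr => i _; exact: TTs.
exact: id.
Qed.

End RowContraction.

(** * The coefficient space inside the Kolmogorov space *)

Lemma sub_Lambda_pred (d N : nat) (a : word d) :
  Lambda (N%:Z - 1) a -> Lambda N%:Z a.
Proof. by move=> Na; apply: le_trans Na _; rewrite lerBlDr lerDl. Qed.

Section KolmogorovEmbedding.
Context (R : realType) (d N : nat) (H G : hilbertType R).
Variable V : word d -> 'L(H, G).
Local Notation M := (kolmogorov_sub N V).

Lemma kvec_bop a : Lambda (N%:Z - 1) a -> kvec N V a \in @bounded_linear R H M.
Proof.
move=> Na; apply/asboolP; split=> [c u v|].
  by apply: val_inj; rewrite linearP/= !val_kvec// linearP.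
have [C _ VC] := bop_bound (V a).
by exists C => u; rewrite -[`|_|]/`|\val (kvec N V a u)| val_kvec.
Qed.

Lemma val_bop : (val : M -> G) \in @bounded_linear R M G.
Proof.
apply/asboolP; split; first exact: linearP.
by exists 1 => x; rewrite mul1r.
Qed.

(** On the whole Kolmogorov space the adjoint of [V a] maps [V b v] to [K a b v].
    The adjoint of the corestriction of [V a] to the subspace is the restriction
    of that operator. *)
Lemma kvec_adjoint (K : kernel d H) a (Na : Lambda (N%:Z - 1) a) :
  Defs.kolmogorov_space (Lambda N%:Z) K V ->
  exists B, adjoint_pair (Bop (kvec_bop Na)) B.
Proof.
move=> [Vd VK].
have [|B VB] := adjoint_of_dense (A := V a) Vd.
  move=> _ [b [v [Nb ->]]]; exists (K a b v) => u; apply: VK => //.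
  exact: sub_Lambda_pred.
exists (bop_comp B (Bop val_bop)) => u x /=.
by rewrite -VB -[LHS]/'[\val (kvec N V a u), \val x] val_kvec.
Qed.

End KolmogorovEmbedding.

(** * The extension theorem *)

Theorem theorem3p2 (R : realType) (d N : nat) (hd : (1 <= d)%N) (hN : (1 <= N)%N)
    (H : hilbertType R) (K : kernel d H)
    (K_pd : positive_definite_on (Lambda N%:Z) K)
    (K_shift : kernel_le_on (Lambda (N%:Z - 1)) (shifted_kernel K) K)
    (K_consistent : shift_consistent N K) :
  exists Kt : kernel d H,
    [/\ positive_definite_on setT Kt,
        kernel_le_on setT (shifted_kernel Kt) Kt &
        forall a b : word d, Lambda N%:Z a -> Lambda N%:Z b -> Kt a b = K a b].
Proof.
have [G [V [VK [T [Ts [TTs TsT T_kvec K_edge K_corner]]]]]] := K_consistent.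
have N0 : Lambda (N%:Z - 1) ([::] : word d) by rewrite /Lambda/= lerBrDr.
have [Xs XXs] := kvec_adjoint N0 VK.
set X := Bop _ in XXs.
exists (orbit_kernel X Xs T Ts); split.
- exact: orbit_kernel_pd.
- exact: orbit_kernel_shift_le.
have prefixE (a : word d) i : Lambda N%:Z (rcons a i) = Lambda (N%:Z - 1) a.
  by rewrite /Lambda/= size_rcons lerBrDr -addn1 PoszD.
have interior a u : Lambda (N%:Z - 1) a -> orbit X T a u = kvec N V a u.
  elim/last_ind: a u => [//|a i IH] u Nai.
  have Na : Lambda (N%:Z - 2) a.
    by move: Nai; rewrite /Lambda/= size_rcons -addn1 PoszD !lerBrDr -addrA.
  rewrite orbit_rcons IH ?T_kvec//; apply: le_trans Na _.
  by rewrite lerD2l lerN2.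
have edge a i u : Lambda N%:Z (rcons a i) ->
    orbit X T (rcons a i) u = T i (kvec N V a u).
  by rewrite prefixE orbit_rcons => /interior ->.
have agree a b u v : Lambda (N%:Z - 1) a -> Lambda N%:Z b ->
    '[orbit X T a u, orbit X T b v] = '[u, K a b v].
  move=> Na Nb; rewrite interior//.
  case/lastP: b Nb => [|b j] Nb.
    rewrite interior// -[LHS]/'[\val _, \val _] !val_kvec//.
    by apply: VK.2 => //; exact: sub_Lambda_pred.
  rewrite edge// -[LHS]/'[\val _, \val _] val_kvec//.
  by rewrite K_edge// -(prefixE b j).
move=> a b Na Nb; apply: val_inj; apply: funext => v /=; apply: inner_injr => u.
rewrite (orbit_kernelE XXs TTs).
case/lastP: a Na => [|a i] Na; first exact: agree.
case/lastP: b Nb => [|b j] Nb; last first.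
  (* The corner identity covers all nonempty words, not only those of length N. *)
  rewrite !edge// -[LHS]/'[\val _, \val _] K_corner//.
  - by rewrite -(prefixE _ i).
  - by rewrite -(prefixE _ j).
(* Now b is empty; the words are exchanged because [agree] needs its first word
   to be shorter than N. *)
by rewrite inner_conj agree// -!VK.2// -inner_conj.
Qed.
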